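(* Let $N_*=(N_{k,i})_{k\ge1,\,i\in\{1,2,3\}}$ be any sequence of positive integers. Let $p_1=(\rho,\varphi_1)$ and $p_2=(\rho,\varphi_2)$ with $0<\rho<1$. Then $$\|\mathbf{n}^\Phi_{\infty}(p_2)-\mathbf{n}^\Phi_{\infty}(p_1)\|\leq \sqrt{2}\sum_{k=1}^{\infty}\sum_{i=1}^{3}\alpha_{k,i}^{\Phi}(\rho)\left|\Delta\cos(2\pi N_{k,i}\varpi_i)\right|+\|\Delta\mathbf{F}_0\|_F,$$ where $\Delta X$ denotes the difference $X(p_2)-X(p_1)$ and $\|\mathbf F\|_F=\sqrt{\|\mathbf F\mathbf e_1\|^2+\|\mathbf F\mathbf e_2\|^2+\|\mathbf F\mathbf e_3\|^2}$ is the Frobenius norm.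
   Context: Points are given in polar coordinates $(\rho,\varphi)$, $0<\rho<1$, $\varphi\in\mathbb{R}/2\pi\mathbb{Z}$; tangent spaces are identified with $\mathbb{R}^2$ by the direct basis $(\partial_\rho,\partial_\varphi)$. $\wedge$ is the cross product in $\mathbb{E}^3$, $(\mathbf e_1,\mathbf e_2,\mathbf e_3)$ the canonical basis; $\Psi^*\langle\cdot,\cdot\rangle(v,w)=\langle\Psi v,\Psi w\rangle$. $J_0$ is the Bessel function of the first kind of order 0, $\kappa_0$ its first positive zero, $J_0^{-1}:\,]0,1]\to[0,\kappa_0[$ the inverse of $J_0|_{[0,\kappa_0[}$. Data. $a=\frac{7}{2\pi}$; $\varpi_1=-\rho$, $\varpi_2=\rho-a\varphi$, $\varpi_3=\rho+a\varphi$; $\ell_i=d\varpi_i$; for $B=E\,d\rho^2+F(d\rho\otimes d\varphi+d\varphi\otimes d\rho)+G\,d\varphi^2$, $H_1(B)=E-\frac{G}{a^2}$, $H_2(B)=\frac{G}{2a^2}-\frac{F}{2a}$, $H_3(B)=\frac{G}{2a^2}+\frac{F}{2a}$ (so $B=\sum_iH_i(B)\ell_i\otimes\ell_i$). $f_0(\rho,\varphi)=2(\rho\cos\varphi,\rho\sin\varphi,\frac{\sqrt2}{2}\rho^2)$, and $g_k=f_0^*\langle\cdot,\cdot\rangle+4\sum_{n=1}^k(n+2)\rho^{2(n+1)}d\rho^2+4\sum_{n=1}^k(n+1)\rho^{2(n+1)}d\varphi^2$. Frame of $(\Psi,\ell)$. For an injective linear map $\Psi:\mathbb{R}^2\to\mathbb{E}^3$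 and a nonzero linear form $\ell$, let $(v,w)$ be a direct basis of $\mathbb{R}^2$ with $\ell(v)>0$, $w\in\ker\ell$; the frame is $(\mathbf t,\mathbf w,\mathbf n)$ with $\mathbf w=\frac{\Psi(w)}{\|\Psi(w)\|}$, $\mathbf n=\frac{\Psi(v)\wedge\Psi(w)}{\|\Psi(v)\wedge\Psi(w)\|}$, $\mathbf t=\mathbf w\wedge\mathbf n$. Formal corrugation process. For $\eta\ge0$ and an integer $N\ge1$, pointwise $FCP(\Phi,\eta,\varpi,N)=\Phi+\big(r(\cos\theta\,\mathbf t+\sin\theta\,\mathbf n)-\Phi(u)\big)\otimes d\varpi$, where $(\mathbf t,\mathbf w,\mathbf n)$ is the frame of $(\Phi,d\varpi)$, $u$ is the vector with $\Phi(u)$ collinear to $\mathbf t$ and $d\varpi(u)=1$, $r=\sqrt{\eta+\|\Phi(u)\|^2}$, $\alpha=J_0^{-1}(\|\Phi(u)\|/r)$, $\theta=\alpha\cos(2\pi N\varpi)$. Formal analogue. $\Phi_{1,0}=df_0$, $\Phi_{k,i}=FCP(\Phi_{k,i-1},\eta_{k,i},\varpi_i,N_{k,i})$ with $\eta_{k,i}=H_i(g_k-\Phi_{k,i-1}^*\langle\cdot,\cdot\rangle)$, $i=1,2,3$, $\Phi_{k+1,0}=\Phi_{k,3}$. This sequence is well defined for every $N_*$ and converges on $0<\rho<1$ to a continuous field $\Phi_\infty$ of injective linear maps with $\Phi_\infty^*\langle\cdot,\cdot\rangle=4\frac{d\rho^2+\rho^2d\varphi^2}{(1-\rho^2)^2}$.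 $\alpha^\Phi_{k,i}$ denotes the amplitude $\alpha$ occurring in the step $(k,i)$, i.e. $\alpha^\Phi_{k,i}=J_0^{-1}\big(\|\Phi_{k,i-1}(u)\|/\sqrt{\eta_{k,i}+\|\Phi_{k,i-1}(u)\|^2}\big)$ with $u$ associated to $(\Phi_{k,i-1},\ell_i)$; it depends only on $\rho$ (neither on $\varphi$ nor on $N_*$). $\mathbf F_0$ is the frame of $(df_0,\ell_1)$, viewed as a $3\times3$ matrix, and $\mathbf n^\Phi_\infty$ is the unit normal of $\Phi_\infty$ (third vector of the frame of $(\Phi_\infty,\ell_1)$). *)

(* Defs.v *)
From HB Require Import structures.
From mathcomp Require Import all_boot all_order all_algebra.
From mathcomp Require Import all_classical all_reals all_analysis.
From mathcomp Require Import ring lra.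

Set Implicit Arguments.
Unset Strict Implicit.
Unset Printing Implicit Defensive.
Import Order.TTheory GRing.Theory Num.Theory numFieldNormedType.Exports.
Local Open Scope classical_set_scope.
Local Open Scope ring_scope.

(* A linear map R^2 -> E^3 is a matrix Psi : 'M_(3, 2) acting by Psi *m v, a
   linear form on R^2 is a row l : 'rV_2 with value [l *m v], a symmetric
   bilinear form is its Gram matrix; coordinate 0 of R^2 is d/drho and
   coordinate 1 is d/dphi.  Fields are functions of (rho, phi); the angle phi
   ranges over R, every field below being 2 pi-periodic in phi. *)

Section Euclidean.
Variable R : realType.

(* The library norm on matrices is the sup norm, hence these definitions. *)
Definition dotp n (u v : 'cV[R]_n) : R := \sum_i u i 0 * v i 0.
Definition enorm n (u : 'cV[R]_n) : R := Num.sqrt (dotp u u).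
Definition normalize n (u : 'cV[R]_n) : 'cV[R]_n := (enorm u)^-1 *: u.

Definition vec3 (x y z : R) : 'cV[R]_3 := \col_i nth 0 [:: x; y; z] i.

Definition cross (u v : 'cV[R]_3) : 'cV[R]_3 :=
  let u_ k := u (inord k) 0 in let v_ k := v (inord k) 0 in
  vec3 (u_ 1 * v_ 2 - u_ 2 * v_ 1)
       (u_ 2 * v_ 0 - u_ 0 * v_ 2)
       (u_ 0 * v_ 1 - u_ 1 * v_ 0).

Definition frobenius (F : 'M[R]_3) : R :=
  Num.sqrt (\sum_(j < 3) enorm (F *m delta_mx j 0) ^+ 2).

Definition form (l : 'rV[R]_2) (v : 'cV[R]_2) : R := (l *m v) 0 0.

Definition pullback (Psi : 'M[R]_(3, 2)) : 'M[R]_2 := Psi^T *m Psi.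

Definition dform (F : R -> R -> R) (rho phi : R) : 'rV[R]_2 :=
  \row_j (if j == 0 then derive1 (fun r => F r phi) rho
          else derive1 (fun t => F rho t) phi).

End Euclidean.

Section Bessel.
Variable R : realType.

Definition besselJ0 (x : R) : R :=
  limn (series (fun m : nat => (-1) ^+ m / (m`!)%:R ^+ 2 * (x / 2) ^+ (2 * m))).

Definition kappa0 : R :=
  xget 0 [set x | [/\ 0 < x, besselJ0 x = 0
                    & forall y, 0 < y -> besselJ0 y = 0 -> x <= y]].

(* Only meaningful on ]0, 1]. *)
Definition besselJ0_inv (y : R) : R :=
  xget 0 [set x | 0 <= x < kappa0 /\ besselJ0 x = y].

End Bessel.

Section Frame.
Variable R : realType.
Implicit Types (Psi : 'M[R]_(3, 2)) (l : 'rV[R]_2) (v w : 'cV[R]_2).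

Definition adapted_basis l v w : Prop :=
  [/\ 0 < \det (row_mx v w), 0 < form l v & form l w = 0].

Definition frame_of Psi v w : 'M[R]_3 :=
  let ww := normalize (Psi *m w) in
  let nn := normalize (cross (Psi *m v) (Psi *m w)) in
  let tt := cross ww nn in
  \matrix_(i, j) nth 0 [:: tt; ww; nn] j i 0.

(* One particular adapted basis; by [frame_indep] below, any other one gives
   the same frame. *)
Definition basis_v l : 'cV[R]_2 := l^T.
Definition basis_w l : 'cV[R]_2 := \col_i (if i == 0 then - l 0 1 else l 0 0).

Definition frame Psi l : 'M[R]_3 := frame_of Psi (basis_v l) (basis_w l).

Definition frame_t Psi l : 'cV[R]_3 := col 0 (frame Psi l).
Definition frame_n Psi l : 'cV[R]_3 := col (inord 2) (frame Psi l).

Lemma det_col2 v w : \det (row_mx v w) = v 0 0 * w 1 0 - v 1 0 * w 0 0.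
Proof.
have e0 i : row_mx v w i 0 = v i 0.
  by rewrite -[RHS](row_mxEl v w); congr (row_mx v w _ _); apply/val_inj.
have e1 i : row_mx v w i 1 = w i 0.
  by rewrite -[RHS](row_mxEr v w); congr (row_mx v w _ _); apply/val_inj.
have det2 (M : 'M[R]_2) : \det M = M 0 0 * M 1 1 - M 0 1 * M 1 0.
  have l0 : lift ord0 ord0 = 1 :> 'I_2 by apply/val_inj.
  have l2 : lift (lift ord0 ord0) 0 = 0 :> 'I_2 by apply/val_inj.
  rewrite (expand_det_row _ 0) big_ord_recl big_ord1 /cofactor !det_mx11 !mxE.
  by rewrite l2 l0 /= expr0 expr1; ring.
by rewrite det2 !e0 !e1; ring.
Qed.

Lemma formE l v : form l v = l 0 0 * v 0 0 + l 0 1 * v 1 0.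
Proof.
rewrite /form mxE big_ord_recl big_ord1.
by rewrite (_ : lift ord0 ord0 = 1) //; apply/val_inj.
Qed.

Lemma normalizeZ n (c : R) (x : 'cV[R]_n) :
  0 < c -> normalize (c *: x) = normalize x.
Proof.
move=> c0; rewrite /normalize /enorm.
have -> : dotp (c *: x) (c *: x) = c ^+ 2 * dotp x x.
  by rewrite /dotp mulr_sumr; apply: eq_bigr => i _; rewrite !mxE; ring.
rewrite sqrtrM ?sqr_ge0// sqrtr_sqr gtr0_norm// invfM scalerA.
by rewrite mulrAC mulVf ?mul1r// gt_eqF.
Qed.

Lemma cross_lin (a b c : R) (x y : 'cV[R]_3) :
  cross (a *: x + b *: y) (c *: y) = (a * c) *: cross x y.
Proof.
by apply/colP => -[[|[|[|//]]] j]; rewrite !mxE /=; ring.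
Qed.

Lemma adapted_basis_vw l : l != 0 -> adapted_basis l (basis_v l) (basis_w l).
Proof.
move=> l0.
have s0 : 0 < l 0 0 * l 0 0 + l 0 1 * l 0 1.
  rewrite -!expr2 lt0r addr_ge0 ?sqr_ge0// andbT.
  apply: contra l0; rewrite paddr_eq0 ?sqr_ge0// !sqrf_eq0 => /andP[/eqP a /eqP b].
  by apply/eqP/rowP => -[[|[|//]] j]; rewrite [RHS]mxE;
    [rewrite -a|rewrite -b]; congr (l _ _); apply/val_inj.
split; rewrite ?det_col2 ?formE /basis_v /basis_w !mxE /=; last by ring.
- by rewrite mulrN opprK.
- exact: s0.
Qed.

Lemma frame_indep Psi l v w :
  adapted_basis l v w -> frame_of Psi v w = frame Psi l.
Proof.
case; rewrite det_col2 !formE => d0 lv lw.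
set s := l 0 0 ^+ 2 + l 0 1 ^+ 2.
have s0 : 0 < s.
  rewrite /s lt0r addr_ge0 ?sqr_ge0// andbT paddr_eq0 ?sqr_ge0// !sqrf_eq0.
  by apply/negP => /andP[/eqP a /eqP b]; move: lv; rewrite a b !mul0r addr0 ltxx.
have sn0 : s != 0 by rewrite gt_eqF.
pose a := (l 0 0 * v 0 0 + l 0 1 * v 1 0) / s.
pose b := (l 0 0 * v 1 0 - l 0 1 * v 0 0) / s.
pose c := (l 0 0 * w 1 0 - l 0 1 * w 0 0) / s.
have a0 : 0 < a by rewrite divr_gt0.
have ord2 (u u' : 'cV[R]_2) : u 0 0 = u' 0 0 -> u 1 0 = u' 1 0 -> u = u'.
  move=> h0 h1; apply/colP => -[[|[|//]] j].
    by rewrite (_ : Ordinal j = 0) //; apply/val_inj.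
  by rewrite (_ : Ordinal j = 1) //; apply/val_inj.
have ve : v = a *: basis_v l + b *: basis_w l.
  by apply: ord2; rewrite !mxE /= /a /b /s; field.
have we : w = c *: basis_w l.
  apply: ord2; rewrite !mxE /= /c; apply: (mulIf sn0).
    have -> : (l 0 0 * w 1 0 - l 0 1 * w 0 0) / s * - l 0 1 * s
      = - (l 0 1 * (l 0 0 * w 1 0) - l 0 1 ^+ 2 * w 0 0) by field.
    have -> : l 0 1 * (l 0 0 * w 1 0) = l 0 0 * (l 0 1 * w 1 0) by ring.
    by rewrite -[l 0 1 * w 1 0](addKr (l 0 0 * w 0 0)) lw /s; ring.
  have -> : (l 0 0 * w 1 0 - l 0 1 * w 0 0) / s * l 0 0 * s
    = l 0 0 ^+ 2 * w 1 0 - l 0 1 * (l 0 0 * w 0 0) by field.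
  by rewrite -[l 0 0 * w 0 0](addrK (l 0 1 * w 1 0)) lw /s; ring.
have c0 : 0 < c.
  have : 0 < c * (l 0 0 * v 0 0 + l 0 1 * v 1 0).
    move: d0; rewrite {1 2}we !mxE /=.
    by congr (0 < _); ring.
  by rewrite pmulr_lgt0.
rewrite /frame /frame_of ve we mulmxDr -!scalemxAr cross_lin !normalizeZ//.
exact: mulr_gt0.
Qed.

End Frame.

Section FCP.
Variable R : realType.
Implicit Types (Psi : 'M[R]_(3, 2)) (l : 'rV[R]_2) (eta : R).

Definition fcp_u Psi l : 'cV[R]_2 :=
  xget 0 [set u | (exists c : R, Psi *m u = c *: frame_t Psi l)
                  /\ form l u = 1].

Definition fcp_radius Psi eta l : R :=
  Num.sqrt (eta + enorm (Psi *m fcp_u Psi l) ^+ 2).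

Definition fcp_amplitude Psi eta l : R :=
  besselJ0_inv (enorm (Psi *m fcp_u Psi l) / fcp_radius Psi eta l).

Definition FCP (Phi : R -> R -> 'M[R]_(3, 2)) (eta varpi : R -> R -> R)
    (N : nat) (rho phi : R) : 'M[R]_(3, 2) :=
  let Psi := Phi rho phi in
  let l := dform varpi rho phi in
  let r := fcp_radius Psi (eta rho phi) l in
  let theta := fcp_amplitude Psi (eta rho phi) l
               * cos (2 * pi * N%:R * varpi rho phi) in
  Psi + (r *: (cos theta *: frame_t Psi l + sin theta *: frame_n Psi l)
         - Psi *m fcp_u Psi l) *m l.

End FCP.

Section Data.
Variable R : realType.

Definition slope : R := 7 / (2 * pi).

(* Used for i = 1, 2, 3 only; the same applies to [ell] and [Hcoef]. *)
Definition varpi (i : nat) (rho phi : R) : R :=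
  match i with
  | 1%N => - rho
  | 2%N => rho - slope * phi
  | _ => rho + slope * phi
  end.

Definition ell (i : nat) (rho phi : R) : 'rV[R]_2 := dform (varpi i) rho phi.

Definition Hcoef (i : nat) (B : 'M[R]_2) : R :=
  let E := B 0 0 in let F := B 0 1 in let G := B 1 1 in
  match i with
  | 1%N => E - G / slope ^+ 2
  | 2%N => G / (2 * slope ^+ 2) - F / (2 * slope)
  | _ => G / (2 * slope ^+ 2) + F / (2 * slope)
  end.

Definition f0 (rho phi : R) : 'cV[R]_3 :=
  2 *: vec3 (rho * cos phi) (rho * sin phi) (Num.sqrt 2 / 2 * rho ^+ 2).

Definition df0 (rho phi : R) : 'M[R]_(3, 2) :=
  \matrix_(i < 3) dform (fun r t => f0 r t i 0) rho phi.

Definition gk (k : nat) (rho phi : R) : 'M[R]_2 :=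
  pullback (df0 rho phi)
  + (4 * \sum_(1 <= n < k.+1) (n + 2)%:R * rho ^+ (2 * (n + 1)))
      *: delta_mx 0 0
  + (4 * \sum_(1 <= n < k.+1) (n + 1)%:R * rho ^+ (2 * (n + 1)))
      *: delta_mx 1 1.

Definition eta_of (k i : nat) (Phi : R -> R -> 'M[R]_(3, 2)) (rho phi : R) : R :=
  Hcoef i (gk k rho phi - pullback (Phi rho phi)).

Section Sequence.
Variable N : nat -> nat -> nat.

Fixpoint steps (k : nat) (Phi0 : R -> R -> 'M[R]_(3, 2)) (i : nat)
    : R -> R -> 'M[R]_(3, 2) :=
  if i is i'.+1 then
    let Psi := steps k Phi0 i' in FCP Psi (eta_of k i Psi) (varpi i) (N k i)
  else Phi0.

(* [Phi_start k] is Phi_{k,0}, for k >= 1 (the value at k = 0 is a dummy). *)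
Fixpoint Phi_start (k : nat) : R -> R -> 'M[R]_(3, 2) :=
  if k is k'.+1 then
    if k' is 0%N then df0 else steps k' (Phi_start k') 3
  else df0.

Definition Phi (k i : nat) : R -> R -> 'M[R]_(3, 2) := steps k (Phi_start k) i.

Definition Phi_inf (rho phi : R) : 'M[R]_(3, 2) :=
  limn (fun k => Phi k 3 rho phi).

(* The value does not depend on phi, nor on N. *)
Definition alphaPhi (k i : nat) (rho phi : R) : R :=
  fcp_amplitude (Phi k i.-1 rho phi) (eta_of k i (Phi k i.-1) rho phi)
    (ell i rho phi).

Definition n_inf (rho phi : R) : 'cV[R]_3 :=
  frame_n (Phi_inf rho phi) (ell 1 rho phi).

End Sequence.

Definition F0 (rho phi : R) : 'M[R]_3 := frame (df0 rho phi) (ell 1 rho phi).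

End Data.

(* Main.v *)
(* The angles of the corrugation steps differ between the two points, but the
   induced metrics do not.  Hence, by induction on the steps, the maps at p_2
   and p_1 differ by a rotation Q_{k,i} of E^3; a step with angles theta_1 at
   p_1 and theta_2 at p_2 replaces Q by Q F R(theta_2 - theta_1) F^T, where F is the
   frame at p_1 and R(t) the rotation by t in the (t, n)-plane, and so moves Q
   by at most sqrt 2 |theta_2 - theta_1| in the Frobenius norm.  If the series
   on the right is finite, then Q_{k,i} converges to a rotation Q with
   n_inf(p_2) = Q n_inf(p_1).  No property of the Bessel function is used beyond
   nonnegativity of the amplitudes, nor is the convergence of the maps: it holds
   at both points or at neither, and in the latter case the two default values
   of the limit coincide. *)
Require Import Defs.
From mathcomp Require Import all_boot all_order all_algebra.
From mathcomp Require Import all_classical all_reals all_analysis.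
From mathcomp Require Import ring lra.

Set Implicit Arguments.
Unset Strict Implicit.
Unset Printing Implicit Defensive.
Import Order.TTheory GRing.Theory Num.Theory numFieldNormedType.Exports.
Local Open Scope classical_set_scope.
Local Open Scope ring_scope.

(** * Rotations and the cross product *)

Section Space.
Variable R : realType.
Implicit Types (u v w x y : 'cV[R]_3) (A B Q : 'M[R]_3) (s t : R).

(** Indices are written [inord k] throughout, to match the coordinates occurring in [cross]. *)
Lemma ord3P (P : 'I_3 -> Prop) :
  P (inord 0) -> P (inord 1) -> P (inord 2) -> forall i, P i.
Proof.
move=> P0 P1 P2 [[|[|[|//]]] lti].
- by rewrite (_ : Ordinal lti = inord 0) //; apply/val_inj; rewrite /= inordK.
- by rewrite (_ : Ordinal lti = inord 1) //; apply/val_inj; rewrite /= inordK.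
- by rewrite (_ : Ordinal lti = inord 2) //; apply/val_inj; rewrite /= inordK.
Qed.

Lemma sum3 (V : nmodType) (F : 'I_3 -> V) :
  \sum_i F i = F (inord 0) + F (inord 1) + F (inord 2).
Proof.
rewrite !big_ord_recr big_ord0 /= add0r.
by congr (F _ + F _ + F _); apply/val_inj; rewrite /= inordK.
Qed.

Lemma colP3 u v : u (inord 0) 0 = v (inord 0) 0 ->
  u (inord 1) 0 = v (inord 1) 0 -> u (inord 2) 0 = v (inord 2) 0 -> u = v.
Proof. by move=> h0 h1 h2; apply/colP; exact: ord3P. Qed.

(** A product of equations acts as one multi-rule for [rewrite]; the same device recurs below. *)
Lemma vec3E s t r : (vec3 s t r (inord 0) 0 = s) * (vec3 s t r (inord 1) 0 = t)
  * (vec3 s t r (inord 2) 0 = r).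
Proof. by rewrite !mxE !inordK. Qed.

Lemma crossE u v :
  (cross u v (inord 0) 0 =
     u (inord 1) 0 * v (inord 2) 0 - u (inord 2) 0 * v (inord 1) 0)
  * (cross u v (inord 1) 0 =
     u (inord 2) 0 * v (inord 0) 0 - u (inord 0) 0 * v (inord 2) 0)
  * (cross u v (inord 2) 0 =
     u (inord 0) 0 * v (inord 1) 0 - u (inord 1) 0 * v (inord 0) 0).
Proof. by rewrite /cross !vec3E. Qed.

Lemma mx_ringE m n :
  (forall (M M' : 'M[R]_(m, n)) i j, (M + M') i j = M i j + M' i j)
  * (forall (M : 'M[R]_(m, n)) i j, (- M) i j = - M i j)
  * (forall s (M : 'M[R]_(m, n)) i j, (s *: M) i j = s * M i j).
Proof. by split=> [|s M i j]; [split=> [M M'|M] i j|]; rewrite mxE. Qed.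

Lemma dotp3E u v : dotp u v = u (inord 0) 0 * v (inord 0) 0
  + u (inord 1) 0 * v (inord 1) 0 + u (inord 2) 0 * v (inord 2) 0.
Proof. exact: sum3. Qed.

Lemma dotpE n (u v : 'cV[R]_n) : dotp u v = (u^T *m v) 0 0.
Proof. by rewrite mxE; apply: eq_bigr => i _; rewrite mxE. Qed.

Lemma dotp_ge0 n (u : 'cV[R]_n) : 0 <= dotp u u.
Proof. by apply: sumr_ge0 => i _; rewrite -expr2 sqr_ge0. Qed.

Lemma dotp_eq0 n (u : 'cV[R]_n) : (dotp u u == 0) = (u == 0).
Proof.
apply/idP/eqP => [|->]; last first.
  by rewrite /dotp big1// => i _; rewrite mxE mul0r.
rewrite psumr_eq0 => [/allP h|i _]; last by rewrite -expr2 sqr_ge0.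
apply/colP => i; rewrite mxE; apply/eqP; rewrite -sqrf_eq0 expr2.
exact: (implyP (h i (mem_index_enum i))).
Qed.

Lemma enorm_sqr n (u : 'cV[R]_n) : enorm u ^+ 2 = dotp u u.
Proof. by rewrite sqr_sqrtr// dotp_ge0. Qed.

Lemma enorm_ge0 n (u : 'cV[R]_n) : 0 <= enorm u.
Proof. exact: sqrtr_ge0. Qed.

Lemma enorm_gt0 n (u : 'cV[R]_n) : (0 < enorm u) = (u != 0).
Proof. by rewrite sqrtr_gt0 lt0r dotp_ge0 andbT dotp_eq0. Qed.

Lemma dotpZ n s t (u v : 'cV[R]_n) : dotp (s *: u) (t *: v) = s * t * dotp u v.
Proof. by rewrite /dotp mulr_sumr; apply: eq_bigr => i _; rewrite !mxE; ring. Qed.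

Lemma dotp_normalize n (u : 'cV[R]_n) :
  u != 0 -> dotp (normalize u) (normalize u) = 1.
Proof.
rewrite -enorm_gt0 => u0; rewrite dotpZ -enorm_sqr.
by field; rewrite gt_eqF.
Qed.

Lemma enorm_normalize_le1 n (u : 'cV[R]_n) : enorm (normalize u) <= 1.
Proof.
have [->|u0] := eqVneq u 0.
  by rewrite /normalize scaler0 /enorm (eqP (_ : dotp _ _ == 0)) ?sqrtr0 ?dotp_eq0.
by rewrite /enorm dotp_normalize// sqrtr1.
Qed.

Lemma normalizeK n (u : 'cV[R]_n) : u != 0 -> enorm u *: normalize u = u.
Proof. by rewrite -enorm_gt0 => u0; rewrite scalerA mulfV ?scale1r// gt_eqF. Qed.

(** Membership in SO(3): compatibility with the cross product stands for determinant 1, and is the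
    form in which orientation acts on frames. *)
Definition isrot Q :=
  Q^T *m Q = 1%:M /\ forall u v, cross (Q *m u) (Q *m v) = Q *m cross u v.

Lemma isrotV Q : isrot Q -> Q *m Q^T = 1%:M.
Proof. by case=> /mulmx1C. Qed.

Lemma isrotM A B : isrot A -> isrot B -> isrot (A *m B).
Proof.
move=> [oA cA] [oB cB]; split=> [|u v]; last by rewrite -!mulmxA cA cB.
by rewrite trmx_mul mulmxA -(mulmxA B^T) oA mulmx1.
Qed.

Lemma isrotT Q : isrot Q -> isrot Q^T.
Proof.
move=> rQ; have [oQ cQ] := rQ; split=> [|u v]; first by rewrite trmxK isrotV.
rewrite -[LHS]mul1mx -oQ -mulmxA; congr (_ *m _).
by rewrite -cQ !mulmxA isrotV// !mul1mx.
Qed.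

Lemma dotp_isrot Q u v : isrot Q -> dotp (Q *m u) (Q *m v) = dotp u v.
Proof.
move=> [oQ _]; rewrite !dotpE trmx_mul.
by rewrite mulmxA -(mulmxA _ Q^T) oQ mulmx1.
Qed.

Lemma enorm_isrot Q u : isrot Q -> enorm (Q *m u) = enorm u.
Proof. by move=> rQ; rewrite /enorm dotp_isrot. Qed.

Lemma normalize_isrot Q u : isrot Q -> normalize (Q *m u) = Q *m normalize u.
Proof. by move=> rQ; rewrite /normalize enorm_isrot// scalemxAr. Qed.

Definition cols3 u v w : 'M[R]_3 := \matrix_(i, j) nth 0 [:: u; v; w] j i 0.

Lemma cols3E u v w i : (cols3 u v w i (inord 0) = u i 0)
  * (cols3 u v w i (inord 1) = v i 0) * (cols3 u v w i (inord 2) = w i 0).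
Proof. by rewrite !mxE !inordK. Qed.

Lemma mul_cols3 u v w x : cols3 u v w *m x =
  x (inord 0) 0 *: u + x (inord 1) 0 *: v + x (inord 2) 0 *: w.
Proof. by apply/colP => i; rewrite mxE sum3 !cols3E !mxE; ring. Qed.

Lemma mulmx_cols3 A u v w : A *m cols3 u v w = cols3 (A *m u) (A *m v) (A *m w).
Proof.
apply/matrixP => i; apply: ord3P; rewrite cols3E !mxE;
  by apply: eq_bigr => j _; rewrite cols3E.
Qed.

Lemma dotp_crossl u v : dotp (cross u v) u = 0.
Proof. by rewrite dotp3E !crossE; ring. Qed.

Lemma dotp_crossr u v : dotp (cross u v) v = 0.
Proof. by rewrite dotp3E !crossE; ring. Qed.

Lemma dotp_cross u v :
  dotp (cross u v) (cross u v) = dotp u u * dotp v v - dotp u v ^+ 2.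
Proof. by rewrite !dotp3E !crossE; ring. Qed.

Lemma cross_crossl u v w : cross (cross u v) w = dotp u w *: v - dotp v w *: u.
Proof. by apply: colP3; rewrite !crossE !mx_ringE !dotp3E; ring. Qed.

Lemma cross_crossr u v w : cross w (cross u v) = dotp v w *: u - dotp u w *: v.
Proof. by apply: colP3; rewrite !crossE !mx_ringE !dotp3E; ring. Qed.

Lemma dotpC n (u v : 'cV[R]_n) : dotp u v = dotp v u.
Proof. by apply: eq_bigr => i _; rewrite mulrC. Qed.

(** With t = v x w, the cyclic table w x t = v, t x v = w holds; expanding a cross product
    bilinearly over t, v, w then gives compatibility. *)
Lemma isrot_cols3 v w : dotp v v = 1 -> dotp w w = 1 -> dotp v w = 0 ->
  isrot (cols3 (cross v w) v w).
Proof.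
move=> vv ww vw; set t := cross v w.
have tt : dotp t t = 1 by rewrite dotp_cross vv ww vw; ring.
have tv : dotp t v = 0 by exact: dotp_crossl.
have tw : dotp t w = 0 by exact: dotp_crossr.
split=> [|x y].
  have dE i j : ((cols3 t v w)^T *m cols3 t v w) i j
      = dotp (col i (cols3 t v w)) (col j (cols3 t v w)).
    by rewrite mxE; apply: eq_bigr => k _; rewrite [_^T _ _]mxE [col i _ _ _]mxE
      [col j _ _ _]mxE.
  have cE : (col (inord 0) (cols3 t v w) = t) * (col (inord 1) (cols3 t v w) = v)
      * (col (inord 2) (cols3 t v w) = w).
    by split; first split; apply/colP => i; rewrite mxE cols3E.
  apply/matrixP; apply: ord3P; apply: ord3P; rewrite dE !cE mxE -val_eqE /= !inordK//=;
    by rewrite ?tt ?vv ?ww ?vw ?tv ?tw // dotpC ?vw ?tv ?tw.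
have tvw : cross t v = w.
  by rewrite cross_crossl vv dotpC vw scale1r scale0r subr0.
have wt : cross w t = v by rewrite cross_crossr ww vw scale1r scale0r subr0.
rewrite !mul_cols3 !crossE.
transitivity ((x (inord 1) 0 * y (inord 2) 0 - x (inord 2) 0 * y (inord 1) 0) *: cross v w +
  (x (inord 2) 0 * y (inord 0) 0 - x (inord 0) 0 * y (inord 2) 0) *: cross w t +
  (x (inord 0) 0 * y (inord 1) 0 - x (inord 1) 0 * y (inord 0) 0) *: cross t v).
  by apply: colP3; rewrite !crossE !mx_ringE /t !crossE; ring.
by rewrite tvw wt.
Qed.

(** Written in the coordinates of a frame (t, w, n): it fixes w and turns t towards n. *)
Definition rot_tn t : 'M[R]_3 :=
  cols3 (vec3 (cos t) 0 (sin t)) (vec3 0 1 0) (vec3 (- sin t) 0 (cos t)).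

Lemma isrot_rot_tn t : isrot (rot_tn t).
Proof.
rewrite /rot_tn (_ : vec3 (cos t) 0 (sin t)
  = cross (vec3 0 1 0) (vec3 (- sin t) 0 (cos t))).
  apply: isrot_cols3; rewrite dotp3E !vec3E; try ring.
  by rewrite mulrNN mul0r addr0 -!expr2 addrC cos2Dsin2.
by apply: colP3; rewrite crossE !vec3E; ring.
Qed.

End Space.

(** * Frobenius norm *)

Section Norms.
Variable R : realType.
Implicit Types (A B Q : 'M[R]_3).

(** Lagrange's identity: the difference of the two sides is half the sum of the squares of the 2 x 2
    minors. *)
Lemma cauchy_schwarz (I : finType) (f g : I -> R) :
  (\sum_i f i * g i) ^+ 2 <= (\sum_i f i ^+ 2) * (\sum_i g i ^+ 2).
Proof.
have : 0 <= \sum_i \sum_j (f i * g j - f j * g i) ^+ 2.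
  by apply: sumr_ge0 => i _; apply: sumr_ge0 => j _; exact: sqr_ge0.
have -> : \sum_i \sum_j (f i * g j - f j * g i) ^+ 2 =
    \sum_i \sum_j (f i ^+ 2 * g j ^+ 2 + g i ^+ 2 * f j ^+ 2
                   - 2 * ((f i * g i) * (f j * g j))).
  by apply: eq_bigr => i _; apply: eq_bigr => j _; ring.
under eq_bigr => i _ do
  rewrite sumrB big_split /= -!mulr_sumr.
rewrite sumrB big_split /= -!mulr_suml -mulr_sumr -mulr_suml.
by set a := \sum_i _; set b := \sum_i _; set c := \sum_i _; lra.
Qed.

Definition l2norm (I : finType) (f : I -> R) := Num.sqrt (\sum_i f i ^+ 2).

Lemma l2normD (I : finType) (f g : I -> R) :
  l2norm (fun i => f i + g i) <= l2norm f + l2norm g.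
Proof.
have sum_ge0 (h : I -> R) : 0 <= \sum_i h i ^+ 2.
  by apply: sumr_ge0 => i _; exact: sqr_ge0.
rewrite -(@ler_pXn2r _ 2) ?nnegrE ?addr_ge0 ?sqrtr_ge0//.
rewrite sqrrD !sqr_sqrtr// -sqrtrM//.
have -> : \sum_i (f i + g i) ^+ 2 =
    \sum_i f i ^+ 2 + (\sum_i f i * g i) *+ 2 + \sum_i g i ^+ 2.
  by rewrite -sumrMnl -!big_split/=; apply: eq_bigr => i _; rewrite sqrrD.
rewrite lerD2r lerD2l lerMn2r /=.
apply: le_trans (ler_norm _) _; rewrite -sqrtr_sqr.
by apply: ler_wsqrtr; exact: cauchy_schwarz.
Qed.

Lemma frobenius_sqr_sum A : \sum_(j < 3) enorm (A *m delta_mx j 0) ^+ 2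
  = \sum_p A p.1 p.2 ^+ 2.
Proof.
rewrite -(pair_bigA _ (fun i j => A i j ^+ 2)) /= exchange_big /=.
apply: eq_bigr => j _; rewrite enorm_sqr; apply: eq_bigr => i _.
by rewrite -colE mxE expr2.
Qed.

Lemma frobeniusE A : frobenius A = l2norm (fun p => A p.1 p.2).
Proof. by rewrite /frobenius frobenius_sqr_sum. Qed.

Lemma frobenius_ge0 A : 0 <= frobenius A.
Proof. exact: sqrtr_ge0. Qed.

Lemma frobeniusD A B : frobenius (A + B) <= frobenius A + frobenius B.
Proof.
rewrite !frobeniusE; apply: le_trans (l2normD _ _).
by rewrite /l2norm; under eq_bigr do rewrite mxE.
Qed.

(** The trace form makes invariance under rotations on either side immediate. *)
Lemma frobenius_tr A : frobenius A = Num.sqrt (\tr (A^T *m A)).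
Proof.
congr Num.sqrt; apply: eq_bigr => j _; rewrite enorm_sqr dotpE trmx_mul.
rewrite !mulmxA -(mulmxA _ A^T) trmx_delta -rowE -colE !mxE.
by apply: eq_bigr => i _; rewrite !mxE.
Qed.

Lemma frobenius_isrotl Q A : isrot Q -> frobenius (Q *m A) = frobenius A.
Proof.
case=> oQ _; rewrite !frobenius_tr trmx_mul.
by rewrite mulmxA -(mulmxA _ Q^T) oQ mulmx1.
Qed.

Lemma frobenius_isrotr Q A : isrot Q -> frobenius (A *m Q) = frobenius A.
Proof.
move=> rQ; rewrite !frobenius_tr trmx_mul.
by rewrite -!mulmxA mxtrace_mulC -!mulmxA isrotV// mulmx1.
Qed.

Lemma normr_le_frobenius A i j : `|A i j| <= frobenius A.
Proof.
rewrite frobeniusE -sqrtr_sqr ler_wsqrtr// (bigD1 (i, j))//= lerDl.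
by apply: sumr_ge0 => p _; exact: sqr_ge0.
Qed.

Lemma enorm_mulmx_le A (u : 'cV[R]_3) : enorm (A *m u) <= frobenius A * enorm u.
Proof.
rewrite -(@ler_pXn2r _ 2) ?nnegrE ?mulr_ge0 ?enorm_ge0 ?frobenius_ge0//.
rewrite exprMn !enorm_sqr sqr_sqrtr; last first.
  by apply: sumr_ge0 => i _; exact: sqr_ge0.
rewrite frobenius_sqr_sum -(pair_bigA _ (fun i j => A i j ^+ 2)) /=.
rewrite mulr_suml; apply: ler_sum => i _; rewrite -expr2 mxE.
apply: le_trans (cauchy_schwarz _ _) _; apply: ler_wpM2l => //.
by apply: sumr_ge0 => j _; exact: sqr_ge0.
Qed.

End Norms.

(** * Trigonometric bounds *)

Section Trigonometry.
Variable R : realType.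

(** Mean value theorem on [0, x]. Iterating it from cos <= 1 yields the successive Taylor bounds
    below. *)
Lemma ge0_of_derive_ge0 (f df : R -> R) : f 0 = 0 ->
  (forall x : R, is_derive x (1 : R) f (df x)) ->
  (forall x, 0 <= x -> 0 <= df x) -> forall x, 0 <= x -> 0 <= f x.
Proof.
move=> f0 fdf df0 x x0.
have [|c] := @MVT_segment R f df 0 x x0 (fun y _ => fdf y).
  apply: continuous_subspaceT => y; apply: differentiable_continuous.
  by apply/derivable1_diffP; case: (fdf y).
rewrite in_itv/= f0 !subr0 => /andP[c0 _] ->.
by rewrite mulr_ge0// df0.
Qed.

Lemma sin_le_id (x : R) : 0 <= x -> sin x <= x.
Proof.
move=> x0; rewrite -subr_ge0; move: x x0.
apply: (@ge0_of_derive_ge0 (fun x => x - sin x) (fun x => 1 - cos x)).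
- by rewrite sin0 subr0.
- by move=> y _; rewrite subr_ge0; exact: cos_le1.
Qed.

Lemma cos_ge_quadratic (x : R) : 1 - x ^+ 2 / 2 <= cos x.
Proof.
wlog x0 : x / 0 <= x.
  move=> h; have [|/ltW x0] := leP 0 x; first exact: h.
  by rewrite -cosN -sqrrN; apply: h; rewrite oppr_ge0.
rewrite -subr_ge0; move: x x0.
apply: (@ge0_of_derive_ge0 (fun x => cos x - (1 - x ^+ 2 / 2)) (fun x => x - sin x)).
- by rewrite cos0 expr0n /= mul0r; ring.
- by move=> y; apply: trigger_derive; rewrite /GRing.scale /=; field.
- by move=> y y0; rewrite subr_ge0; exact: sin_le_id.
Qed.

Lemma sin_ge_cubic (x : R) : 0 <= x -> x - x ^+ 3 / 6 <= sin x.
Proof.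
move=> x0; rewrite -subr_ge0; move: x x0.
apply: (@ge0_of_derive_ge0 (fun x => sin x - (x - x ^+ 3 / 6))
  (fun x => cos x - (1 - x ^+ 2 / 2))).
- by rewrite sin0 expr0n /= mul0r; ring.
- by move=> y; apply: trigger_derive; rewrite /GRing.scale /=; field.
- by move=> y y0; rewrite subr_ge0; exact: cos_ge_quadratic.
Qed.

Lemma cos_le_quartic (x : R) : 0 <= x -> cos x <= 1 - x ^+ 2 / 2 + x ^+ 4 / 24.
Proof.
move=> x0; rewrite -subr_ge0; move: x x0.
apply: (@ge0_of_derive_ge0 (fun x => 1 - x ^+ 2 / 2 + x ^+ 4 / 24 - cos x)
  (fun x => sin x - (x - x ^+ 3 / 6))).
- by rewrite cos0 !expr0n /= !mul0r; ring.
- by move=> y; apply: trigger_derive; rewrite /GRing.scale /=; field.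
- by move=> y y0; rewrite subr_ge0; exact: sin_ge_cubic.
Qed.

(** Otherwise 7/4 would be at most pi/2, where cos is nonnegative; but the quartic bound is negative
    at 7/4. *)
Lemma pi_lt_7half : pi < 7 / 2 :> R.
Proof.
rewrite ltNge; apply/negP => le_pi.
have : 0 <= cos (7 / 4 : R).
  by apply: cos_ge0_pihalf; have := @pi_gt0 R; lra.
have := @cos_le_quartic (7 / 4).
by lra.
Qed.

(** The squared norm equals 4 (1 - cos (t - s)), which is at most 2 (t - s)^2. This is the source of
    the factor sqrt 2 in the theorem. *)
Lemma rot_tn_lipschitz (s t : R) :
  frobenius (rot_tn t - rot_tn s) <= Num.sqrt 2 * `|t - s|.
Proof.
rewrite -sqrtr_sqr -sqrtrM// frobeniusE; apply: ler_wsqrtr.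
rewrite -(pair_bigA _ (fun i j => (rot_tn t - rot_tn s) i j ^+ 2)) /=.
rewrite !sum3 !mx_ringE !cols3E !vec3E.
have := cos_ge_quadratic (t - s); rewrite cosB.
have := cos2Dsin2 t; have := cos2Dsin2 s.
by lra.
Qed.

End Trigonometry.

(** * Frames and the corrugation process *)

Section Frames.
Variable R : realType.
Implicit Types (Psi : 'M[R]_(3, 2)) (l m : 'rV[R]_2) (v w u : 'cV[R]_2).
Implicit Types (Q : 'M[R]_3).

Lemma sum2 (V : nmodType) (F : 'I_2 -> V) : \sum_i F i = F 0 + F 1.
Proof.
by rewrite big_ord_recl big_ord1; congr (_ + F _); apply/val_inj.
Qed.

Lemma det2 (A : 'M[R]_2) : \det A = A 0 0 * A 1 1 - A 0 1 * A 1 0.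
Proof.
have AE : A = row_mx (col 0 A) (col 1 A).
  apply/matrixP => i j; rewrite [RHS]mxE; case: splitP => k; rewrite ord1 => jk;
    rewrite mxE; congr (A _ _); exact: val_inj.
by rewrite {1}AE det_col2 !mxE; ring.
Qed.

Lemma ord2P (P : 'I_2 -> Prop) : P 0 -> P 1 -> forall i, P i.
Proof.
move=> P0 P1 [[|[|//]] lti].
  by rewrite (_ : Ordinal lti = 0) //; apply/val_inj.
by rewrite (_ : Ordinal lti = 1) //; apply/val_inj.
Qed.

Lemma mulmx_col2 Psi v : Psi *m v = v 0 0 *: col 0 Psi + v 1 0 *: col 1 Psi.
Proof. by apply/colP => i; rewrite mxE sum2 !mxE mulrC (mulrC (v 1 0)). Qed.

Lemma pullbackE Psi i j : pullback Psi i j = dotp (col i Psi) (col j Psi).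
Proof. by rewrite mxE; apply: eq_bigr => k _; rewrite !mxE. Qed.

Lemma det_pullback Psi : \det (pullback Psi) =
  dotp (cross (col 0 Psi) (col 1 Psi)) (cross (col 0 Psi) (col 1 Psi)).
Proof.
by rewrite det2 !pullbackE dotp_cross (dotpC (col 1 _)) expr2.
Qed.

(** The determinant of [(basis_v l, basis_w l)], and also the value of [l] on [basis_v l]. *)
Definition basis_det l : R := l 0 0 ^+ 2 + l 0 1 ^+ 2.

Lemma basis_det_gt0 l : l != 0 -> 0 < basis_det l.
Proof.
move=> l0; rewrite lt0r addr_ge0 ?sqr_ge0// andbT.
apply: contra l0; rewrite paddr_eq0 ?sqr_ge0// !sqrf_eq0 => /andP[/eqP a /eqP b].
by apply/eqP/rowP; apply: ord2P; rewrite mxE.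
Qed.

Lemma cross_basis Psi l : cross (Psi *m basis_v l) (Psi *m basis_w l) =
  basis_det l *: cross (col 0 Psi) (col 1 Psi).
Proof.
rewrite !mulmx_col2 !mxE /= /basis_det.
by apply: colP3; rewrite !mx_ringE !crossE !mx_ringE; ring.
Qed.

Lemma gram_rowE l i j : (l^T *m l) i j = l 0 i * l 0 j.
Proof. by rewrite mxE big_ord1 !mxE. Qed.

(** Injectivity of [Psi], expressed through the induced metric alone so that it can be followed
    along the steps. *)
Definition regular Psi : Prop := 0 < \det (pullback Psi).

Lemma cross_basis_neq0 Psi l : regular Psi -> l != 0 ->
  cross (Psi *m basis_v l) (Psi *m basis_w l) != 0.
Proof.
move=> rPsi /basis_det_gt0 l0; rewrite cross_basis scaler_eq0 gt_eqF//=.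
by rewrite -dotp_eq0 -det_pullback gt_eqF.
Qed.

Lemma cross0r (x : 'cV[R]_3) : cross x 0 = 0.
Proof. by apply: colP3; rewrite !crossE !mxE; ring. Qed.

Lemma basis_w_neq0 Psi l : regular Psi -> l != 0 -> Psi *m basis_w l != 0.
Proof.
move=> rPsi l0; apply: contra (cross_basis_neq0 rPsi l0) => /eqP ->.
by rewrite cross0r.
Qed.

Definition frame_w Psi l := normalize (Psi *m basis_w l).

Lemma frameE Psi l : frame Psi l
  = cols3 (frame_t Psi l) (frame_w Psi l) (frame_n Psi l).
Proof.
have E : frame Psi l = cols3 (cross (frame_w Psi l)
  (normalize (cross (Psi *m basis_v l) (Psi *m basis_w l)))) (frame_w Psi l)
  (normalize (cross (Psi *m basis_v l) (Psi *m basis_w l))) by [].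
apply/matrixP => i; apply: ord3P; rewrite cols3E.
- rewrite [RHS]mxE; congr (frame _ _ _ _); apply/val_inj; rewrite /= inordK//.
- by rewrite E cols3E.
- by rewrite [RHS]mxE.
Qed.

Lemma frame_nE Psi l : frame_n Psi l =
  normalize (cross (Psi *m basis_v l) (Psi *m basis_w l)).
Proof.
apply/colP => i; rewrite mxE.
exact: (cols3E (cross (frame_w Psi l) _) (frame_w Psi l) _ i).2.
Qed.

Lemma frame_tE Psi l : frame_t Psi l = cross (frame_w Psi l) (frame_n Psi l).
Proof.
apply/colP => i; rewrite mxE frame_nE.
rewrite (_ : 0 = inord 0 :> 'I_3); last by apply/val_inj; rewrite /= inordK.
exact: (cols3E _ (frame_w Psi l) _ i).1.1.
Qed.

Lemma isrot_frame Psi l : regular Psi -> l != 0 -> isrot (frame Psi l).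
Proof.
move=> rPsi l0; rewrite frameE frame_tE; apply: isrot_cols3.
- by rewrite dotp_normalize// basis_w_neq0.
- by rewrite frame_nE dotp_normalize// cross_basis_neq0.
- by rewrite frame_nE dotpZ dotpC dotp_crossr mulr0.
Qed.

Lemma frame_nM Q Psi l : isrot Q -> frame_n (Q *m Psi) l = Q *m frame_n Psi l.
Proof.
by move=> rQ; rewrite !frame_nE -!mulmxA rQ.2 normalize_isrot.
Qed.

Lemma frame_wM Q Psi l : isrot Q -> frame_w (Q *m Psi) l = Q *m frame_w Psi l.
Proof. by move=> rQ; rewrite /frame_w -mulmxA normalize_isrot. Qed.

Lemma frame_tM Q Psi l : isrot Q -> frame_t (Q *m Psi) l = Q *m frame_t Psi l.
Proof. by move=> rQ; rewrite !frame_tE frame_wM// frame_nM// rQ.2. Qed.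

Lemma frameM Q Psi l : isrot Q -> frame (Q *m Psi) l = Q *m frame Psi l.
Proof.
by move=> rQ; rewrite !frameE mulmx_cols3 frame_tM// frame_wM// frame_nM.
Qed.

(** The corrugation at one point with the angle as a free parameter, so that the angles at the two
    points can be compared. *)
Definition fcp_map Psi eta l (theta : R) : 'M[R]_(3, 2) :=
  Psi + (fcp_radius Psi eta l
           *: (cos theta *: frame_t Psi l + sin theta *: frame_n Psi l)
         - Psi *m fcp_u Psi l) *m l.

(** The frame vector t rotates with the map, so both sets of candidates coincide, and [xget] makes
    the same choice on equal sets. *)
Lemma fcp_uM Q Psi l : isrot Q -> fcp_u (Q *m Psi) l = fcp_u Psi l.
Proof.
move=> rQ; congr xget; apply/seteqP; split=> u /= [[c uc] lu1]; split=> //; exists c.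
  rewrite -[LHS]mul1mx -rQ.1 -mulmxA (mulmxA Q) uc frame_tM//.
  by rewrite -scalemxAr mulmxA rQ.1 mul1mx.
by rewrite -mulmxA uc frame_tM// scalemxAr.
Qed.

Lemma fcp_radiusM Q Psi eta l : isrot Q ->
  fcp_radius (Q *m Psi) eta l = fcp_radius Psi eta l.
Proof. by move=> rQ; rewrite /fcp_radius fcp_uM// -mulmxA enorm_isrot. Qed.

Lemma fcp_amplitudeM Q Psi eta l : isrot Q ->
  fcp_amplitude (Q *m Psi) eta l = fcp_amplitude Psi eta l.
Proof.
move=> rQ; rewrite /fcp_amplitude (fcp_radiusM _ _ _ rQ) (fcp_uM _ _ rQ).
by rewrite -mulmxA (enorm_isrot _ rQ).
Qed.

Lemma fcp_mapM Q Psi eta l theta : isrot Q ->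
  fcp_map (Q *m Psi) eta l theta = Q *m fcp_map Psi eta l theta.
Proof.
move=> rQ; rewrite /fcp_map fcp_radiusM// fcp_uM// frame_tM// frame_nM//.
by rewrite mulmxDr !mulmxA mulmxBr -!scalemxAr mulmxDr -!scalemxAr !mulmxA.
Qed.

(** Gram-Schmidt: removing from [Psi *m basis_v l] its component along [Psi *m basis_w l] leaves a
    multiple of t, and dividing by [basis_det l] normalizes the value of [l]. *)
Lemma fcp_uP Psi l : regular Psi -> l != 0 ->
  (exists c : R, Psi *m fcp_u Psi l = c *: frame_t Psi l)
  /\ Defs.form l (fcp_u Psi l) = 1.
Proof.
move=> rPsi l0.
have s0 := basis_det_gt0 l0; have w0 := basis_w_neq0 rPsi l0.
suff : exists u : 'cV[R]_2, (exists c : R, Psi *m u = c *: frame_t Psi l)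
    /\ Defs.form l u = 1 by exact: (xgetPex 0).
set V := Psi *m basis_v l; set W := Psi *m basis_w l.
have W0 : 0 < dotp W W by rewrite -enorm_sqr exprn_gt0// enorm_gt0.
pose u := (basis_det l)^-1 *: basis_v l
  - (dotp V W / dotp W W / basis_det l) *: basis_w l.
have uE : Psi *m u = (basis_det l)^-1 *: (V - (dotp V W / dotp W W) *: W).
  rewrite mulmxBr -!scalemxAr scalerBr scalerA; congr (_ - _ *: _).
  by rewrite mulrC.
exists u; split; last first.
  rewrite formE !mxE /=.
  transitivity ((basis_det l)^-1 * (l 0 0 ^+ 2 + l 0 1 ^+ 2)); first by ring.
  by rewrite mulVf// gt_eqF.
(* This constant comes from W x (V x W) = (W.W) V - (V.W) W, where the left side is |W| |V x W|
   times t. *)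
exists ((basis_det l)^-1 * enorm W * enorm (cross V W) / dotp W W).
have tE : frame_t Psi l = ((enorm W)^-1 * (enorm (cross V W))^-1)
    *: cross W (cross V W).
  rewrite frame_tE frame_nE /frame_w /normalize -/V -/W.
  by apply: colP3; rewrite !crossE !mx_ringE !crossE; ring.
rewrite uE tE scalerA cross_crossr.
have -> : (basis_det l)^-1 * enorm W * enorm (cross V W) / dotp W W *
    ((enorm W)^-1 / enorm (cross V W)) = (basis_det l)^-1 / dotp W W.
  have eW : enorm W != 0 by rewrite gt_eqF// enorm_gt0.
  have eC : enorm (cross V W) != 0.
    by rewrite gt_eqF// enorm_gt0 cross_basis_neq0.
  by field; rewrite eW eC !gt_eqF.
rewrite -[RHS]scalerA; congr (_ *: _).
by rewrite scalerBr !scalerA mulVf ?gt_eqF// scale1r mulrC.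
Qed.

(* The form dual to [u] in the basis [(u, basis_w l)] when [l u = 1]. *)
Definition dual_form u : 'rV[R]_2 := \row_j (if j == 0 then - u 1 0 else u 0 0).

Lemma dual_basis l u : Defs.form l u = 1 ->
  u *m l + basis_w l *m dual_form u = 1%:M.
Proof.
rewrite formE => lu; apply/matrixP; apply: ord2P; apply: ord2P;
  rewrite !mxE !big_ord1 !mxE /= ?mulr1n ?mulr0n -?lu; ring.
Qed.

(** Coordinates, in a frame (t, w, n), of a map with t-component [c *: l], w-component [b *: m] and
    no normal component. *)
Definition frame_coords (c b : R) l m : 'M[R]_(3, 2) :=
  delta_mx (inord 0) 0 *m (c *: l) + delta_mx (inord 1) 0 *m (b *: m).

(** In the frame of [Psi], a corrugation only replaces the length [c] by the radius and then turns
    the t-component by theta in the (t, n)-plane. The vector w is fixed by that turn, so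
    [rot_tn theta] factors out of the whole map. *)
Lemma frame_decomposition Psi l : regular Psi -> l != 0 ->
  exists c b m, [/\ enorm (Psi *m fcp_u Psi l) ^+ 2 = c ^+ 2,
   l 0 0 * m 0 1 - l 0 1 * m 0 0 = 1,
   Psi = frame Psi l *m frame_coords c b l m &
   forall eta theta, fcp_map Psi eta l theta =
     frame Psi l *m rot_tn theta *m frame_coords (fcp_radius Psi eta l) b l m].
Proof.
move=> rPsi l0; have [[c uc] lu] := fcp_uP rPsi l0.
have rF := isrot_frame rPsi l0.
have w0 := basis_w_neq0 rPsi l0.
set u := fcp_u Psi l in uc lu *.
pose b := enorm (Psi *m basis_w l); pose m := dual_form u.
have PsiE : Psi = (c *: frame_t Psi l) *m l + (b *: frame_w Psi l) *m m.
  by rewrite -uc normalizeK// -!mulmxA -mulmxDr dual_basis// mulmx1.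
have FE x : frame Psi l *m x = x (inord 0) 0 *: frame_t Psi l
    + x (inord 1) 0 *: frame_w Psi l + x (inord 2) 0 *: frame_n Psi l.
  by rewrite frameE mul_cols3.
have Ft : frame_t Psi l = frame Psi l *m delta_mx (inord 0) 0.
  by rewrite FE !mxE -!val_eqE /= !inordK//= scale1r !scale0r !addr0.
have Fw : frame_w Psi l = frame Psi l *m delta_mx (inord 1) 0.
  by rewrite FE !mxE -!val_eqE /= !inordK//= scale1r !scale0r !addr0 add0r.
exists c, b, m; split.
- rewrite enorm_sqr uc dotpZ Ft dotp_isrot// dotp3E !mxE -!val_eqE /= !inordK//=.
  by ring.
- by move: lu; rewrite formE !mxE /= => <-; ring.
- rewrite {1}PsiE mulmxDr !mulmxA -Ft -Fw -!scalemxAr -!scalemxAl.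
  by [].
move=> eta theta; rewrite /fcp_map {1}PsiE -/u uc.
(* The subtracted term [Psi *m fcp_u Psi l] cancels exactly the t-component of [Psi]. *)
rewrite mulmxBl addrC addrA subrK.
have rE : (rot_tn theta *m delta_mx (inord 0) 0 = vec3 (cos theta) 0 (sin theta))
    * (rot_tn theta *m delta_mx (inord 1) 0 = vec3 0 1 0).
  by split; rewrite mul_cols3 !mxE -!val_eqE /= !inordK//= scale1r !scale0r
    ?addr0 ?add0r.
rewrite mulmxDr !mulmxA -!(mulmxA _ (rot_tn _)) !rE !FE !vec3E.
rewrite !scale0r scale1r !addr0 add0r -!scalemxAr -!scalemxAl.
by [].
Qed.

Lemma pullback_isrot Q Psi : isrot Q -> pullback (Q *m Psi) = pullback Psi.
Proof.
by move=> [oQ _]; rewrite /pullback trmx_mul mulmxA -(mulmxA _ Q^T) oQ mulmx1.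
Qed.

Lemma pullback_frame_coords c b l m : pullback (frame_coords c b l m)
  = c ^+ 2 *: (l^T *m l) + b ^+ 2 *: (m^T *m m).
Proof.
apply/matrixP => i j; rewrite pullbackE dotp3E /frame_coords.
rewrite !mxE !big_ord1 !mxE -!val_eqE /= !inordK//=.
ring.
Qed.

(** The rotations on the left drop out and [c ^+ 2] becomes [eta + c ^+ 2]; [0 <= eta] allows the
    root in [fcp_radius] to be squared back. *)
Lemma pullback_fcp_map Psi eta l theta : regular Psi -> l != 0 -> 0 <= eta ->
  pullback (fcp_map Psi eta l theta) = pullback Psi + eta *: (l^T *m l).
Proof.
move=> rPsi l0 eta0; have [c [b [m [uc lm PsiE ->]]]] := frame_decomposition rPsi l0.
have rF := isrot_frame rPsi l0; have rR := isrot_rot_tn theta.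
rewrite -mulmxA !pullback_isrot// [in RHS]PsiE pullback_isrot//.
rewrite !pullback_frame_coords /fcp_radius sqr_sqrtr; last first.
  by rewrite addr_ge0// sqr_ge0.
by rewrite uc scalerDl -addrA addrC.
Qed.

(** A rank-one update adds to the Gram determinant [eta] times the squared length of the image of
    [basis_w l], which is nonnegative. *)
Lemma regular_fcp_map Psi eta l theta : regular Psi -> l != 0 -> 0 <= eta ->
  regular (fcp_map Psi eta l theta).
Proof.
move=> rPsi l0 eta0; rewrite /regular pullback_fcp_map//.
have -> : \det (pullback Psi + eta *: (l^T *m l)) =
    \det (pullback Psi) + eta * dotp (Psi *m basis_w l) (Psi *m basis_w l).
  rewrite mulmx_col2 !det2 !mx_ringE !gram_rowE !pullbackE !dotp3E !mx_ringE.
  by rewrite !mxE /=; ring.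
by rewrite ltr_wpDr// mulr_ge0// dotp_ge0.
Qed.

Lemma fcp_map_rotate Psi eta l s t : regular Psi -> l != 0 ->
  let F := frame Psi l in
  fcp_map Psi eta l t = F *m (rot_tn t *m (rot_tn s)^T) *m F^T *m fcp_map Psi eta l s.
Proof.
move=> rPsi l0 F; have [c [b [m [_ _ _ fE]]]] := frame_decomposition rPsi l0.
rewrite !fE -/F !mulmxA -(mulmxA _ F^T) (isrot_frame rPsi l0).1 mulmx1.
by rewrite -(mulmxA _ (rot_tn s)^T) (isrot_rot_tn s).1 mulmx1.
Qed.

Lemma fcp_step Q Psi eta l s t : regular Psi -> l != 0 -> isrot Q ->
  exists Q', [/\ isrot Q',
    fcp_map (Q *m Psi) eta l t = Q' *m fcp_map Psi eta l s &
    frobenius (Q' - Q) <= Num.sqrt 2 * `|t - s|].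
Proof.
move=> rPsi l0 rQ; have rF := isrot_frame rPsi l0; set F := frame Psi l in rF.
pose S := rot_tn t *m (rot_tn s)^T.
have rS : isrot S by apply: isrotM; [|apply: isrotT]; exact: isrot_rot_tn.
exists (Q *m (F *m S *m F^T)); split.
- apply: isrotM => //; apply: isrotM; [exact: isrotM|exact: isrotT].
- by rewrite fcp_mapM// (fcp_map_rotate eta s t)// !mulmxA.
(* Writing the identity as a rotation times its transpose exposes a difference of two [rot_tn]
   between Frobenius isometries. *)
have -> : Q *m (F *m S *m F^T) - Q
    = Q *m (F *m ((rot_tn t - rot_tn s) *m (rot_tn s)^T) *m F^T).
  rewrite mulmxBl isrotV; last exact: isrot_rot_tn.
  by rewrite mulmxBr mulmx1 mulmxBl (isrotV rF) mulmxBr mulmx1.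
rewrite frobenius_isrotl// frobenius_isrotr; last exact: isrotT.
rewrite frobenius_isrotl// frobenius_isrotr; last exact/isrotT/isrot_rot_tn.
exact: rot_tn_lipschitz.
Qed.

Lemma isrot_frameE Q Psi l : isrot Q -> regular Psi -> l != 0 ->
  frame (Q *m Psi) l *m (frame Psi l)^T = Q.
Proof.
move=> rQ rPsi l0; rewrite frameM// -mulmxA isrotV ?mulmx1//.
exact: isrot_frame.
Qed.

End Frames.

(** * The surface and the metrics g_k *)

Section SurfaceData.
Variable R : realType.
Implicit Types (rho phi : R).

Lemma derive1_val (f : R -> R) (x df : R) : is_derive x (1 : R) f df -> derive1 f x = df.
Proof. by move=> fdf; rewrite derive1E; exact: derive_val. Qed.

Lemma slope_gt1 : 1 < slope R.
Proof.
have pi0 := pi_gt0 R; have pi7 := pi_lt_7half R.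
by rewrite /slope ltr_pdivlMr; lra.
Qed.

(** Each varpi_i is affine, so its differential is the same at all points, in particular at p_1 and
    p_2. *)
Definition ell_row (i : nat) : 'rV[R]_2 := \row_j
  if j == 0 then (if i is 1%N then -1 else 1)
  else match i with 1%N => 0 | 2%N => - slope R | _ => slope R end.

Lemma ellE i rho phi : ell i rho phi = ell_row i.
Proof.
apply/rowP; apply: ord2P; rewrite !mxE /=; case: i => [|[|[|i]]] /=;
  apply: derive1_val; apply: trigger_derive; rewrite /GRing.scale /=; ring.
Qed.

Lemma ell_row_neq0 i : ell_row i != 0.
Proof.
apply/negP => /eqP/rowP/(_ 0); rewrite !mxE /=.
by case: i => [|[|i]]; lra.
Qed.

Lemma col_df0 rho phi :
  (col 0 (df0 rho phi) = vec3 (2 * cos phi) (2 * sin phi) (2 * Num.sqrt 2 * rho))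
  * (col 1 (df0 rho phi) = vec3 (- (2 * rho * sin phi)) (2 * rho * cos phi) 0).
Proof.
have f0E r t : (f0 r t (inord 0) 0 = 2 * (r * cos t))
   * (f0 r t (inord 1) 0 = 2 * (r * sin t))
   * (f0 r t (inord 2) 0 = 2 * (Num.sqrt 2 / 2 * r ^+ 2)).
  by rewrite /f0 !mx_ringE !vec3E.
split; apply: colP3; rewrite vec3E !mxE /=; under eq_fun do rewrite f0E;
  apply: derive1_val; apply: trigger_derive; rewrite /GRing.scale /=; by field.
Qed.

Definition rot_z (t : R) : 'M[R]_3 :=
  cols3 (vec3 (cos t) (sin t) 0) (vec3 (- sin t) (cos t) 0) (vec3 0 0 1).

Lemma isrot_rot_z t : isrot (rot_z t).
Proof.
rewrite /rot_z (_ : vec3 (cos t) (sin t) 0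
  = cross (vec3 (- sin t) (cos t) 0) (vec3 0 0 1)).
  apply: isrot_cols3; rewrite dotp3E !vec3E; try ring.
  by rewrite mulrNN mul0r addr0 -!expr2 addrC cos2Dsin2.
by apply: colP3; rewrite crossE !vec3E; ring.
Qed.

(** The initial surface is of revolution about the third axis, so the addition formulas give the
    rotation starting the induction. *)
Lemma df0_rot rho phi1 phi2 :
  df0 rho phi2 = rot_z (phi2 - phi1) *m df0 rho phi1.
Proof.
apply/matrixP => i j; move: j i.
suff h : forall j, col j (df0 rho phi2) = rot_z (phi2 - phi1) *m col j (df0 rho phi1).
  move=> j i; have /colP/(_ i) := h j; rewrite mxE => ->.
  by rewrite colE mulmxA -colE mxE.
have [d ->] : exists d, phi2 = d + phi1 by exists (phi2 - phi1); rewrite subrK.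
rewrite addrK; apply: ord2P; rewrite !col_df0 mul_cols3 !vec3E;
  by apply: colP3; rewrite !mx_ringE !vec3E ?cosD ?sinD; ring.
Qed.

Lemma pullback_df0 rho phi :
  (pullback (df0 rho phi) 0 0 = 4 + 8 * rho ^+ 2)
  * (pullback (df0 rho phi) 0 1 = 0) * (pullback (df0 rho phi) 1 0 = 0)
  * (pullback (df0 rho phi) 1 1 = 4 * rho ^+ 2).
Proof.
have s2 : Num.sqrt 2 ^+ 2 = 2 :> R by rewrite sqr_sqrtr.
have cs := cos2Dsin2 phi.
rewrite !pullbackE !col_df0 !dotp3E !vec3E; do !split; last 3 first.
- by ring.
- by ring.
- transitivity (4 * rho ^+ 2 * (cos phi ^+ 2 + sin phi ^+ 2)); first by ring.
  by rewrite cs mulr1.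
transitivity (4 * (cos phi ^+ 2 + sin phi ^+ 2) + 4 * Num.sqrt 2 ^+ 2 * rho ^+ 2).
  by ring.
by rewrite cs s2; ring.
Qed.

Lemma regular_df0 rho phi : 0 < rho -> regular (df0 rho phi).
Proof.
move=> rho0; rewrite /regular det2 !pullback_df0 mulr0 subr0.
have r20 : 0 < rho ^+ 2 by rewrite exprn_gt0.
by rewrite mulr_gt0; lra.
Qed.

(** For k >= 1 this is g_k - g_{k-1}; it does not depend on the angle. *)
Definition gk_incr k rho : 'M[R]_2 :=
  (4 * ((k + 2)%:R * rho ^+ (2 * (k + 1)))) *: delta_mx 0 0
  + (4 * ((k + 1)%:R * rho ^+ (2 * (k + 1)))) *: delta_mx 1 1.

Lemma gk0 rho phi : gk 0 rho phi = pullback (df0 rho phi).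
Proof. by rewrite /gk !big_geq// !mulr0 !scale0r !addr0. Qed.

Lemma gkS k rho phi : gk k.+1 rho phi = gk k rho phi + gk_incr k.+1 rho.
Proof.
rewrite /gk /gk_incr !(big_nat_recr k.+1)//= !mulrDr !scalerDl.
by rewrite -!addrA; congr (_ + (_ + _)); rewrite addrCA.
Qed.

Lemma HcoefDZ i (A B : 'M[R]_2) s : Hcoef i (A + s *: B) = Hcoef i A + s * Hcoef i B.
Proof. by case: i => [|[|[|i]]]; rewrite /Hcoef !mx_ringE; ring. Qed.

(** This duality keeps the three steps of a stage from interfering: step j changes the metric only
    along its own form. *)
Lemma Hcoef_dual i j : (1 <= i <= 3)%N -> (1 <= j <= 3)%N ->
  Hcoef i ((ell_row j)^T *m ell_row j) = (i == j)%:R.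
Proof.
have s0 : slope R != 0 by have := slope_gt1; lra.
by case: i => [|[|[|[|i]]]]// _; case: j => [|[|[|[|j]]]]// _;
  rewrite /Hcoef !gram_rowE !mxE /=; field.
Qed.

(* The case i = 1 is where a > 1, that is pi < 7/2, is needed. *)
Lemma Hcoef_incr_ge0 i k rho : (1 <= i <= 3)%N -> 0 <= rho ->
  0 <= Hcoef i (gk_incr k rho).
Proof.
move=> i13 rho0; have s1 := slope_gt1.
have x0 : 0 <= rho ^+ (2 * (k + 1)) by rewrite exprn_ge0.
have dE : (gk_incr k rho 0 0 = 4 * ((k + 2)%:R * rho ^+ (2 * (k + 1))))
    * (gk_incr k rho 0 1 = 0) * (gk_incr k rho 1 0 = 0)
    * (gk_incr k rho 1 1 = 4 * ((k + 1)%:R * rho ^+ (2 * (k + 1)))).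
  by rewrite /gk_incr !mxE /= ; do !split; ring.
have s2 : 1 <= slope R ^+ 2 by rewrite exprn_ege1// ltW.
have s0 : 0 < 2 * slope R ^+ 2 by lra.
have G0 : 0 <= gk_incr k rho 1 1 by rewrite dE mulr_ge0// mulr_ge0.
case: i i13 => [|[|[|[|i]]]]// _; rewrite /Hcoef; last first.
- by rewrite !dE mul0r addr0 -dE divr_ge0// ltW.
- by rewrite !dE mul0r subr0 -dE divr_ge0// ltW.
rewrite subr_ge0 ler_pdivrMr ?(lt_le_trans _ s2)//.
apply: (@le_trans _ _ (gk_incr k rho 0 0)).
  by rewrite !dE ler_wpM2l// ler_wpM2r// ler_nat leq_add2l.
by rewrite ler_peMr// dE mulr_ge0// mulr_ge0.
Qed.

Lemma Hcoef_decomposition k rho : \sum_(1 <= j < 4)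
  Hcoef j (gk_incr k rho) *: ((ell_row j)^T *m ell_row j) = gk_incr k rho.
Proof.
have s0 : slope R != 0 by have := slope_gt1; lra.
rewrite big_ltn// big_ltn// big_nat1.
by apply/matrixP; apply: ord2P; apply: ord2P; rewrite !mx_ringE !gram_rowE /Hcoef !mxE /=;
  field.
Qed.

(** Both the chosen preimage and the default 0 of [xget] are nonnegative. *)
Lemma besselJ0_inv_ge0 (y : R) : 0 <= besselJ0_inv y.
Proof. by rewrite /besselJ0_inv; case: xgetP => [x _ [/andP[]]|]. Qed.

End SurfaceData.

(** * The corrugation sequence *)

Section CorrugationSequence.
Variables (R : realType) (N : nat -> nat -> nat) (rho : R).
Hypothesis rho0 : 0 < rho.
Local Opaque fcp_amplitude.

(* The metric induced by Phi_{k+1,i}: mind the shift of k. *)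
Definition partial_metric k i phi : 'M[R]_2 :=
  gk k rho phi + \sum_(1 <= j < i.+1)
  Hcoef j (gk_incr k.+1 rho) *: ((ell_row R j)^T *m ell_row R j).

Lemma PhiSE k i phi : Phi N k i.+1 rho phi =
  fcp_map (Phi N k i rho phi) (eta_of k i.+1 (Phi N k i) rho phi)
    (ell i.+1 rho phi)
    (alphaPhi N k i.+1 rho phi * cos (2 * pi * (N k i.+1)%:R * varpi i.+1 rho phi)).
Proof. by []. Qed.

(** By duality, the earlier terms j < n <= i all have zero i-th coefficient. *)
Lemma Hcoef_incr_sub i n k : (1 <= i <= 3)%N -> (n <= i)%N ->
  Hcoef i (gk_incr k rho - \sum_(1 <= j < n)
    Hcoef j (gk_incr k rho) *: ((ell_row R j)^T *m ell_row R j))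
  = Hcoef i (gk_incr k rho).
Proof.
move=> i13; elim: n => [|[|n] IHn] ni; [by rewrite big_geq// subr0..|].
rewrite big_nat_recr//= opprD addrA -scaleNr HcoefDZ IHn; last exact: ltnW.
rewrite Hcoef_dual//; last by case/andP: i13 => _; exact: leq_trans (ltnW ni).
by rewrite gtn_eqF// mulr0 addr0.
Qed.

Lemma eta_ofE k i phi : (i < 3)%N ->
  pullback (Phi N k.+1 i rho phi) = partial_metric k i phi ->
  eta_of k.+1 i.+1 (Phi N k.+1 i) rho phi = Hcoef i.+1 (gk_incr k.+1 rho).
Proof.
move=> i3 pE; rewrite /eta_of pE /partial_metric gkS opprD addrACA subrr add0r.
exact: Hcoef_incr_sub.
Qed.

(** Both claims go through one induction: the metric identifies eta as a nonnegative coefficient of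
    the increment, which the next regularity uses, and regularity gives the next metric. *)
Lemma metric_Phi k i phi : (i <= 3)%N ->
  regular (Phi N k.+1 0 rho phi) ->
  pullback (Phi N k.+1 0 rho phi) = gk k rho phi ->
  regular (Phi N k.+1 i rho phi) /\
  pullback (Phi N k.+1 i rho phi) = partial_metric k i phi.
Proof.
move=> + reg0 p0; elim: i => [_|i IHi i3].
  by split=> //; rewrite p0 /partial_metric big_geq// addr0.
have [regi pi] := IHi (ltnW i3).
have H0 : 0 <= Hcoef i.+1 (gk_incr k.+1 rho) by apply: Hcoef_incr_ge0 => //; exact: ltW.
rewrite PhiSE eta_ofE// ellE; split.
  by apply: regular_fcp_map => //; exact: ell_row_neq0.
rewrite pullback_fcp_map ?ell_row_neq0// pi /partial_metric.
by rewrite [in RHS]big_nat_recr//= addrA.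
Qed.

Lemma metric_Phi_start k phi : regular (Phi N k.+1 0 rho phi) /\
  pullback (Phi N k.+1 0 rho phi) = gk k rho phi.
Proof.
elim: k => [|k [reg0 p0]].
  by rewrite gk0; split=> //; exact: regular_df0.
have [reg3 p3] := metric_Phi (leqnn 3) reg0 p0.
(* The start of the next stage is convertible to step 3 of this one, and the three terms add up to
   the full increment. *)
by split; [exact: reg3|rewrite gkS [LHS]p3 /partial_metric Hcoef_decomposition].
Qed.

Lemma regular_Phi k i phi : (i <= 3)%N -> regular (Phi N k.+1 i rho phi).
Proof.
by move=> i3; have [reg0 p0] := metric_Phi_start k phi; case: (metric_Phi i3 reg0 p0).
Qed.

Lemma eta_PhiE k i phi : (i < 3)%N ->
  eta_of k.+1 i.+1 (Phi N k.+1 i) rho phi = Hcoef i.+1 (gk_incr k.+1 rho).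
Proof.
move=> i3; have [reg0 p0] := metric_Phi_start k phi.
by apply: eta_ofE => //; have [] := metric_Phi (ltnW i3) reg0 p0.
Qed.

(** The coefficient eta is the same at both angles, and the amplitude is invariant under rotations
    of the map. *)
Lemma alphaPhi_rot k i Q phi1 phi2 : (i < 3)%N -> isrot Q ->
  Phi N k.+1 i rho phi2 = Q *m Phi N k.+1 i rho phi1 ->
  alphaPhi N k.+1 i.+1 rho phi2 = alphaPhi N k.+1 i.+1 rho phi1.
Proof.
move=> i3 rQ PhiE; rewrite /alphaPhi [i.+1.-1]/=.
by rewrite (eta_PhiE _ _ i3) (eta_PhiE _ _ i3) !ellE PhiE (fcp_amplitudeM _ _ _ rQ).
Qed.

(** The amplitude is read at a separate angle [phi], as in the theorem; [alphaPhi_const] later moves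
    it to [phi1]. *)
Definition osc k i phi phi1 phi2 : R := alphaPhi N k i rho phi *
  `|cos (2 * pi * (N k i)%:R * varpi i rho phi2)
    - cos (2 * pi * (N k i)%:R * varpi i rho phi1)|.

Lemma osc_ge0 k i phi phi1 phi2 : 0 <= osc k i phi phi1 phi2.
Proof. by rewrite mulr_ge0//; exact: besselJ0_inv_ge0. Qed.

Lemma Phi_rot_step k i Q phi1 phi2 : (i < 3)%N -> isrot Q ->
  Phi N k.+1 i rho phi2 = Q *m Phi N k.+1 i rho phi1 ->
  exists Q', [/\ isrot Q',
    Phi N k.+1 i.+1 rho phi2 = Q' *m Phi N k.+1 i.+1 rho phi1 &
    frobenius (Q' - Q) <= Num.sqrt 2 * osc k.+1 i.+1 phi1 phi1 phi2].
Proof.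
move=> i3 rQ PhiE; rewrite !PhiSE (alphaPhi_rot i3 rQ PhiE) !(eta_PhiE _ _ i3) !ellE PhiE.
set s := _ * cos (_ * varpi _ _ phi1); set t := _ * cos (_ * varpi _ _ phi2).
have [Q' [rQ' E le_Q]] := fcp_step (Hcoef i.+1 (gk_incr k.+1 rho)) s t
  (regular_Phi k phi1 (ltnW i3)) (ell_row_neq0 R i.+1) rQ.
exists Q'; split=> //; move: le_Q; rewrite /s /t -mulrBr normrM.
by rewrite ger0_norm//; exact: besselJ0_inv_ge0.
Qed.

Lemma Phi_rot k i Q phi1 phi2 : (i <= 3)%N -> isrot Q ->
  Phi N k.+1 0 rho phi2 = Q *m Phi N k.+1 0 rho phi1 ->
  exists Q', [/\ isrot Q',
    Phi N k.+1 i rho phi2 = Q' *m Phi N k.+1 i rho phi1 &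
    frobenius (Q' - Q) <= Num.sqrt 2 *
      \sum_(1 <= j < i.+1) osc k.+1 j phi1 phi1 phi2].
Proof.
move=> + rQ E0; elim: i => [_|i IHi i3].
  exists Q; split=> //; rewrite big_geq// mulr0 subrr frobenius_tr mulmx0.
  by rewrite raddf0 sqrtr0.
have [Q1 [rQ1 E1 le1]] := IHi (ltnW i3).
have [Q2 [rQ2 E2 le2]] := Phi_rot_step i3 rQ1 E1.
exists Q2; split=> //; rewrite big_nat_recr//= mulrDr.
rewrite -(subrK Q1 Q2) -addrA addrC; apply: le_trans (frobeniusD _ _) _.
exact: lerD.
Qed.

(* By [transport_eq], the only rotation taking Phi_{k+1,0} at phi1 to its value
   at phi2. *)
Definition transport phi1 phi2 k : 'M[R]_3 :=
  frame (Phi N k.+1 0 rho phi2) (ell_row R 1)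
  *m (frame (Phi N k.+1 0 rho phi1) (ell_row R 1))^T.

Lemma transport_eq phi1 phi2 k Q : isrot Q ->
  Phi N k.+1 0 rho phi2 = Q *m Phi N k.+1 0 rho phi1 -> transport phi1 phi2 k = Q.
Proof.
move=> rQ E; rewrite /transport E isrot_frameE//; last exact: ell_row_neq0.
exact: regular_Phi.
Qed.

(** Some rotation exists by induction on the stages, and [transport_eq] identifies it with the
    closed formula, so no sequence of choices is made. *)
Lemma transportP phi1 phi2 k : isrot (transport phi1 phi2 k) /\
  Phi N k.+1 0 rho phi2 = transport phi1 phi2 k *m Phi N k.+1 0 rho phi1.
Proof.
suff [Q [rQ E]] : exists Q, isrot Q /\
    Phi N k.+1 0 rho phi2 = Q *m Phi N k.+1 0 rho phi1.
  by rewrite (transport_eq rQ E).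
elim: k => [|k [Q [rQ E]]].
  by exists (rot_z (phi2 - phi1)); split; [exact: isrot_rot_z|exact: df0_rot].
by have [Q' [rQ' E' _]] := Phi_rot (leqnn 3) rQ E; exists Q'.
Qed.

Lemma alphaPhi_const phi phi' k i : (1 <= i <= 3)%N ->
  alphaPhi N k.+1 i rho phi = alphaPhi N k.+1 i rho phi'.
Proof.
move=> /andP[i0 i3]; rewrite -(prednK i0) in i3 *.
have [rQ E] := transportP phi' phi k.
have [Q' [rQ' E' _]] := Phi_rot (ltnW i3) rQ E.
exact: (alphaPhi_rot i3 rQ' E').
Qed.

Lemma transport_incr phi phi1 phi2 k :
  frobenius (transport phi1 phi2 k.+1 - transport phi1 phi2 k) <=
  Num.sqrt 2 * \sum_(1 <= i < 4) osc k.+1 i phi phi1 phi2.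
Proof.
have [rQ E] := transportP phi1 phi2 k.
have [Q' [rQ' E' le_Q]] := Phi_rot (leqnn 3) rQ E.
rewrite (@transport_eq _ _ k.+1 Q' rQ' E').
have -> : \sum_(1 <= i < 4) osc k.+1 i phi phi1 phi2
    = \sum_(1 <= i < 4) osc k.+1 i phi1 phi1 phi2; last exact: le_Q.
by apply: eq_big_nat => i i3; rewrite /osc (alphaPhi_const phi phi1 _ i3).
Qed.

(** The initial transport is the frame at [phi2] times the transposed frame at [phi1]; factoring out
    the latter yields the last term of the bound. *)
Lemma transport0 phi1 phi2 : frobenius (transport phi1 phi2 0 - 1%:M)
  = frobenius (F0 rho phi2 - F0 rho phi1).
Proof.
have rF : isrot (frame (df0 rho phi1) (ell_row R 1)).
  by apply: isrot_frame; [exact: regular_df0|exact: ell_row_neq0].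
rewrite /F0 !ellE -(isrotV rF) -mulmxBl frobenius_isrotr//.
exact: isrotT.
Qed.

Lemma transport_dist phi phi1 phi2 n :
  frobenius (transport phi1 phi2 n - 1%:M) <=
  Num.sqrt 2 * \sum_(1 <= k < n.+1) \sum_(1 <= i < 4) osc k i phi phi1 phi2
  + frobenius (F0 rho phi2 - F0 rho phi1).
Proof.
elim: n => [|n IHn]; first by rewrite transport0 big_geq// mulr0 add0r.
have -> : transport phi1 phi2 n.+1 - 1%:M = (transport phi1 phi2 n.+1
    - transport phi1 phi2 n) + (transport phi1 phi2 n - 1%:M).
  by rewrite addrA subrK.
apply: le_trans (frobeniusD _ _) _.
rewrite big_nat_recr//= mulrDr -addrA [leRHS]addrCA.
exact: (lerD (transport_incr phi phi1 phi2 n) IHn).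
Qed.

End CorrugationSequence.

(** * Limits *)

Section MatrixLimits.
Variable R : realType.

Lemma cvg_mxP m n (u : nat -> 'M[R]_(m, n)) (A : 'M[R]_(m, n)) :
  u k @[k --> \oo] --> A <-> forall i j, u k i j @[k --> \oo] --> A i j.
Proof.
split=> [uA i j|uA].
  exact: (@cvg_comp _ _ _ u (fun M : 'M[R]_(m, n) => M i j) _ _ _ uA
    (@coord_continuous _ _ _ i j A)).
(* A matrix neighbourhood contains a product of neighbourhoods [P i j] of the entries, and finitely
   many eventual conditions hold together. *)
move=> S [P PA PS]; rewrite /nbhs /=.
have h : \forall k \near \oo, forall i j, P i j (u k i j).
  apply: filter_forall => i; apply: filter_forall => j; exact: (uA i j _ (PA i j)).
by apply: filterS h => k Pk; apply: PS.
Qed.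

Lemma cvg_mulmx m n p (u : nat -> 'M[R]_(m, n)) (v : nat -> 'M[R]_(n, p))
    (A : 'M[R]_(m, n)) (B : 'M[R]_(n, p)) :
  u k @[k --> \oo] --> A -> v k @[k --> \oo] --> B ->
  u k *m v k @[k --> \oo] --> A *m B.
Proof.
move=> /cvg_mxP uA /cvg_mxP vB; apply/cvg_mxP => i j; rewrite mxE.
under eq_fun do rewrite mxE.
by apply: cvg_big => [|l _]; [exact: add_continuous|exact: cvgM].
Qed.

(** Relating positive indices only leaves out the dummy stage 0 of the corrugation sequence. *)
Lemma cvg_mulmx_shift m n p (T : nat -> 'M[R]_(m, n)) (u : nat -> 'M[R]_(n, p))
    (v : nat -> 'M[R]_(m, p)) (Q : 'M[R]_(m, n)) (A : 'M[R]_(n, p)) :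
  T k @[k --> \oo] --> Q -> u k @[k --> \oo] --> A ->
  (forall k, v k.+1 = T k.+1 *m u k.+1) -> v k @[k --> \oo] --> Q *m A.
Proof.
move=> TQ uA vE; rewrite -(cvg_shiftS v) (funext vE).
by apply: cvg_mulmx; rewrite ?(cvg_shiftS T) ?(cvg_shiftS u).
Qed.

Lemma cvg_trmx m n (u : nat -> 'M[R]_(m, n)) (A : 'M[R]_(m, n)) :
  u k @[k --> \oo] --> A -> (u k)^T @[k --> \oo] --> A^T.
Proof.
move=> /cvg_mxP uA; apply/cvg_mxP => i j; rewrite mxE.
by under eq_fun do rewrite mxE; exact: uA.
Qed.

Lemma cvg_cross (u v : nat -> 'cV[R]_3) (x y : 'cV[R]_3) :
  u k @[k --> \oo] --> x -> v k @[k --> \oo] --> y ->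
  cross (u k) (v k) @[k --> \oo] --> cross x y.
Proof.
move=> /cvg_mxP ux /cvg_mxP vy; apply/cvg_mxP; apply: ord3P => j; rewrite ord1 crossE;
  under eq_fun do rewrite crossE; by apply: cvgB; apply: cvgM.
Qed.

Lemma isrot_cvg (u : nat -> 'M[R]_3) (Q : 'M[R]_3) : u k @[k --> \oo] --> Q ->
  (forall k, isrot (u k)) -> isrot Q.
Proof.
move=> uQ ru; split=> [|x y].
  apply: (@cvg_unique _ _ ((u k)^T *m u k @[k --> \oo])) => //.
    by apply: cvg_mulmx => //; exact: cvg_trmx.
  rewrite (_ : (fun k => (u k)^T *m u k) = fun=> 1%:M); first exact: cvg_cst.
  by apply/funext => k; rewrite (ru k).1.
apply: (@cvg_unique _ _ (cross (u k *m x) (u k *m y) @[k --> \oo])) => //.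
  by apply: cvg_cross; apply: cvg_mulmx => //; exact: cvg_cst.
rewrite (_ : (fun k => cross (u k *m x) (u k *m y)) = fun k => u k *m cross x y).
  by apply: cvg_mulmx => //; exact: cvg_cst.
by apply/funext => k; rewrite (ru k).2.
Qed.

Lemma frobenius_cvg_le (u : nat -> 'M[R]_3) (Q : 'M[R]_3) c : u k @[k --> \oo] --> Q ->
  (forall k, frobenius (u k) <= c) -> frobenius Q <= c.
Proof.
move=> /cvg_mxP uQ uc.
suff uQf : frobenius (u k) @[k --> \oo] --> frobenius Q.
  by apply: (cvgr_to_le uQf); exact: nearW.
rewrite frobeniusE; under eq_fun do rewrite frobeniusE.
apply: continuous_cvg; first exact: sqrt_continuous.
apply: cvg_big => [|p _]; first exact: add_continuous.
exact: (cvgM (uQ p.1 p.2) (uQ p.1 p.2)).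
Qed.

(** The telescoping series of [u] converges absolutely, its partial sums of absolute values being
    nondecreasing and bounded by [c]. *)
Lemma bounded_variation_cvg (u : nat -> R) (b : nat -> R) (c : R) :
  (forall n, `|u n.+1 - u n| <= b n) ->
  (forall n, \sum_(0 <= k < n) b k <= c) -> cvgn u.
Proof.
move=> ub bc.
have nd : nondecreasing_seq (series (fun k => `|telescope u k|)).
  by apply/nondecreasing_seqP => n; rewrite seriesSr lerDl.
have : cvgn (series (telescope u)).
  apply: normed_cvg; apply: (nondecreasing_is_cvgn nd).
  exists c => _ [n _ <-]; apply: le_trans (bc n).
  by rewrite /series /=; apply: ler_sum => k _; exact: ub.
rewrite telescopeK => cu.
have : cvgn ((fun n => u n - u 0%N) \+ (fun=> u 0%N)).
  by apply: is_cvgD => //; exact: is_cvg_cst.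
by congr (cvgn _); apply/funext => n /=; rewrite subrK.
Qed.

End MatrixLimits.

Theorem proposition49 (R : realType) (N : nat -> nat -> nat)
    (hN : forall k i : nat, (1 <= k)%N -> (1 <= i <= 3)%N -> (0 < N k i)%N)
    (rho : R) (hrho : 0 < rho < 1) (phi1 phi2 phi : R) :
  ((enorm (n_inf N rho phi2 - n_inf N rho phi1))%:E <=
   (Num.sqrt 2)%:E *
     (\sum_(1 <= k <oo) (\sum_(1 <= i < 4)
        alphaPhi N k i rho phi *
        `|cos (2 * pi * (N k i)%:R * varpi i rho phi2)
          - cos (2 * pi * (N k i)%:R * varpi i rho phi1)|)%R%:E)
   + (frobenius (F0 rho phi2 - F0 rho phi1))%:E)%E.
Proof.
have rho0 : 0 < rho by case/andP: hrho.
set a := fun k : nat => \sum_(1 <= i < 4) osc N rho k i phi phi1 phi2.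
have a_ge0 k : 0 <= a k by apply: sumr_ge0 => i _; exact: osc_ge0.
rewrite [X in (_ * X)%E](_ : _ = \sum_(1 <= k <oo) (a k)%:E)%E; last by [].
set S := (\sum_(1 <= k <oo) _)%E; set D := frobenius _.
have S_ge0 : (0 <= S)%E by apply: nneseries_ge0 => k _ _; rewrite lee_fin.
have partial_le n : ((\sum_(1 <= k < n.+1) a k)%:E <= S)%E.
  by rewrite -sumEFin; apply: nneseries_lim_ge => k _ _; rewrite lee_fin.
have s2 : 0 < Num.sqrt 2 :> R by rewrite sqrtr_gt0.
(* An infinite sum makes the right side +oo, and -oo is excluded by [S_ge0]; the finite value [s]
   remains. *)
move: S S_ge0 partial_le => [s||//] S_ge0 partial_le; last first.
  by rewrite gt0_muley ?lte_fin// addye// leey.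
have {}partial_le n : \sum_(1 <= k < n.+1) a k <= s by rewrite -lee_fin.
rewrite -EFinM -EFinD lee_fin.
set T := transport N rho phi1 phi2.
pose Q : 'M[R]_3 := \matrix_(i, j) limn (fun n => T n i j).
have TQ : T n @[n --> \oo] --> Q.
  apply/cvg_mxP => i j; rewrite mxE.
  (* The increment of [T] at [n] is produced by stage [n.+1], hence [a n.+1]. *)
  apply: (@bounded_variation_cvg _ _ (fun n => Num.sqrt 2 * a n.+1) (Num.sqrt 2 * s)) => n.
    apply: le_trans (transport_incr N rho0 phi phi1 phi2 n).
    by apply: le_trans (normr_le_frobenius _ i j); rewrite !mx_ringE.
  by rewrite -mulr_sumr ler_pM2l//; have := partial_le n; rewrite big_add1.
have rT n : isrot (T n) by case: (transportP N rho0 phi1 phi2 n).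
have rQ : isrot Q by exact: isrot_cvg TQ rT.
have PhiT n : Phi N n.+1 0 rho phi2 = T n *m Phi N n.+1 0 rho phi1.
  by case: (transportP N rho0 phi1 phi2 n).
have Q1_le : frobenius (Q - 1%:M) <= Num.sqrt 2 * s + D.
  apply: (@frobenius_cvg_le _ (fun n => T n - 1%:M)).
    by apply: cvgB => //; exact: cvg_cst.
  move=> n; apply: le_trans (transport_dist N rho0 phi phi1 phi2 n) _.
  by rewrite lerD2r ler_pM2l.
pose v f k := Phi N k 3 rho f.
(* Phi_{k+1,3} is Phi_{k+2,0} by definition, and [T k.+1] is the rotation attached to the latter. *)
have vS k : v phi2 k.+1 = T k.+1 *m v phi1 k.+1 by exact: (PhiT k.+1).
have vS' k : v phi1 k.+1 = (T k.+1)^T *m v phi2 k.+1.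
  by rewrite vS mulmxA (rT _).1 mul1mx.
have [cv1|ncv1] := pselect (cvgn (v phi1)); last first.
  have ncv2 : ~ cvgn (v phi2).
    move=> cv2; apply: ncv1; apply/cvg_ex; exists (Q^T *m limn (v phi2)).
    exact: (cvg_mulmx_shift (cvg_trmx TQ) cv2 vS').
  (* Both limits take the same default value and the forms agree, so the normals are equal and the
     left side is 0. *)
  rewrite /n_inf !ellE /Phi_inf -/(v phi1) -/(v phi2) (dvgP ncv1) (dvgP ncv2).
  rewrite subrr /enorm (eqP (_ : dotp 0 0 == 0)) ?dotp_eq0// sqrtr0.
  by apply: addr_ge0; [rewrite mulr_ge0// ltW|exact: frobenius_ge0].
have v2Q : v phi2 k @[k --> \oo] --> Q *m limn (v phi1).
  exact: (cvg_mulmx_shift TQ cv1 vS).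
have nE : n_inf N rho phi2 = Q *m n_inf N rho phi1.
  have limE : Phi_inf N rho phi2 = Q *m Phi_inf N rho phi1.
    exact: (cvg_lim (@norm_hausdorff _ _) v2Q).
  by rewrite /n_inf !ellE limE (frame_nM _ _ rQ).
(* A normalized vector has norm 1, or 0 when the vector itself is 0. *)
have n1 : enorm (n_inf N rho phi1) <= 1.
  by rewrite /n_inf frame_nE enorm_normalize_le1.
(* The difference of normals is [Q - 1%:M] applied to a vector of norm at most 1. *)
rewrite nE -[X in _ - X]mul1mx -mulmxBl.
apply: le_trans (enorm_mulmx_le _ _) _; apply: le_trans Q1_le.
by rewrite ler_piMr// frobenius_ge0.
Qed.
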